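(* Let $(T_n)_{n\ge 2}$ be the sequence of random trees generated by the Barabási–Albert preferential attachment model, $T_n$ having $n$ vertices. Then, with high probability, $\limsup_{n\to\infty}\mathcal{E}(T_n)/n\le 0.96$; that is, for every $\varepsilon>0$, $$\lim_{n\to\infty}\mathbb{P}\left(\frac{\mathcal{E}(T_n)}{n}\le 0.96+\varepsilon\right)=1 .$$
   Context: The energy $\mathcal{E}(G)$ of a finite simple graph $G$ is the sum of the absolute values of the eigenvalues (with multiplicity) of its adjacency matrix. Barabási–Albert tree model: $T_2$ is a single edge on two vertices; given $T_n$, the tree $T_{n+1}$ is obtained by adding one new vertex and joining it by an edge to exactly one vertex $v$ of $T_n$ chosen at random with probability $d_{T_n}(v)/(2(n-1))$, i.e. proportional to its current degree. *)

(* Defs.v *)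
From HB Require Import structures.
From mathcomp Require Import all_boot all_order all_algebra.
From mathcomp Require Import all_classical all_reals all_analysis.

Set Implicit Arguments.
Unset Strict Implicit.
Unset Printing Implicit Defensive.
Import Order.TTheory GRing.Theory Num.Theory.
Import numFieldNormedType.Exports.
Local Open Scope classical_set_scope.
Local Open Scope ring_scope.

Definition simple n (e : {ffun 'I_n * 'I_n -> bool}) : bool :=
  [forall i, ~~ e (i, i)] && [forall i, forall j, e (i, j) == e (j, i)].

Record sgraph (n : nat) := SGraph {
  edges : {ffun 'I_n * 'I_n -> bool};
  edges_simple : simple edges }.

HB.instance Definition _ (n : nat) := [isSub for @edges n].
HB.instance Definition _ (n : nat) := [Countable of sgraph n by <:].
HB.instance Definition _ (n : nat) := [Finite of sgraph n by <:].

Definition adj n (G : sgraph n) (i j : 'I_n) : bool := edges G (i, j).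

Definition degree n (G : sgraph n) (v : 'I_n) : nat := #|[set j | adj G v j]%SET|.

Definition adjacency_matrix (R : realType) n (G : sgraph n) : 'M[R]_n :=
  \matrix_(i, j) (adj G i j)%:R.

(* The matrix is real symmetric, so all its eigenvalues lie in [R]; each one
   is counted with its multiplicity as a root of the characteristic polynomial.
   The index set is finite, so the finitely supported sum is the actual sum. *)
Definition energy (R : realType) n (G : sgraph n) : R :=
  let A := adjacency_matrix R G in
  \sum_(x \in [set x : R | eigenvalue A x]) `|x| *+ mup x (char_poly A).

Definition edge2_fun : {ffun 'I_2 * 'I_2 -> bool} := [ffun p => p.1 != p.2].

Lemma edge2_simple : simple edge2_fun.
Proof.
apply/andP; split; apply/forallP => i; first by rewrite ffunE /= eqxx.
by apply/forallP => j; rewrite !ffunE /= (eq_sym i j).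
Qed.

Definition edge2 : sgraph 2 := SGraph edge2_simple.

(* The new vertex is [ord_max]; an old vertex [i] becomes [lift ord_max i],
   which has the same value as [i]. *)
Definition add_leaf_fun n (G : sgraph n) (v : 'I_n) :
    {ffun 'I_n.+1 * 'I_n.+1 -> bool} :=
  [ffun p => match unlift ord_max p.1, unlift ord_max p.2 with
             | Some i, Some j => adj G i j
             | Some i, None => i == v
             | None, Some j => j == v
             | None, None => false
             end].

Lemma add_leaf_simple n (G : sgraph n) (v : 'I_n) : simple (add_leaf_fun G v).
Proof.
have /andP[/forallP irrG /forallP symG] := edges_simple G.
apply/andP; split; apply/forallP => i.
  by rewrite ffunE /=; case: (unlift _ _) => [i'|//]; exact: irrG.
apply/forallP => j; rewrite !ffunE /=.
case: (unlift _ i) => [i'|]; case: (unlift _ j) => [j'|] //.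
exact: (forallP (symG i')).
Qed.

Definition add_leaf n (G : sgraph n) (v : 'I_n) : sgraph n.+1 :=
  SGraph (add_leaf_simple G v).

(* [T n] is the tree on [n] vertices, labelled by order of arrival; the values
   at [n < 2] are irrelevant. Since [T n] determines [T k] for [2 <= k <= n],
   conditioning on [T n] is the same as conditioning on the whole history.
   The conditional law of [T n.+1] given [T n = G] is written in product form,
   which also makes sense when [T n = G] has probability 0. *)
Record barabasi_albert (R : realType) (d : measure_display)
    (Omega : measurableType d) (P : probability Omega R)
    (T : forall n : nat, Omega -> sgraph n) : Prop := BarabasiAlbert {
  ba_measurable : forall (n : nat) (G : sgraph n),
    measurable [set w | T n w = G];
  ba_init : P [set w | T 2%N w = edge2] = 1%E;
  ba_step : forall (n : nat) (G : sgraph n) (v : 'I_n), (2 <= n)%N ->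
    P [set w | T n w = G /\ T n.+1 w = add_leaf G v] =
    (P [set w | T n w = G] * ((degree G v)%:R / (2 * (n%:R - 1)))%:E)%E }.

(* Main.v *)
(* Let S be the sign of the adjacency matrix A: a Hermitian unitary matrix with
   E(G) = tr (S A). Each row of S has norm 1, so AM-GM on each |S_uv| gives,
   for any positive vertex weights x,
     E(G) <= sum_v x_v + 1/2 sum_(u ~ v) 1 / (x_u + x_v),
   the second sum ranging over ordered pairs of adjacent vertices. With x_v a
   function of min (deg v, 8), the right-hand side is a linear combination of
   the numbers of vertices of degree > i and of adjacent pairs of degrees
   > i and > j. These counts have drifts linear in counts of lower index, with
   a damping term, so by induction their second moments about c (n - 1) are
   O(n), where c = 2 / ((i+1)(i+2)), respectively
   c = 4 / ((i+1)(j+1)) - 4 / ((i+j+1)(i+j+2)). The weights below make the limit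
   of the right-hand side divided by n about 0.9598, and Chebyshev's inequality
   concludes. *)
Require Import Defs.
From mathcomp Require Import all_boot all_order all_algebra.
From mathcomp Require Import all_classical all_reals all_analysis.
From mathcomp Require Import complex spectral ring lra.
Import Order.TTheory GRing.Theory Num.Theory.
Import numFieldNormedType.Exports.
Local Open Scope classical_set_scope.
Local Open Scope ring_scope.
Set Implicit Arguments.
Unset Strict Implicit.
Unset Printing Implicit Defensive.

(** * Bounding the energy by degrees *)

(** The multiplicity of a root of a split polynomial is its number of occurrences in the list, so
    the sum over distinct eigenvalues regroups equal entries of [s]. *)
Lemma energy_split (R : realType) n (G : sgraph n) (s : seq R) :
  char_poly (adjacency_matrix R G) = \prod_(x <- s) ('X - x%:P) ->
  energy R G = \sum_(x <- s) `|x|.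
Proof.
move=> hs; rewrite /energy hs -[RHS]big_undup_iterop_count /=.
rewrite (_ : [set x | _] = [set` undup s]); last first.
  apply/seteqP; split => x /=;
    by rewrite eigenvalue_root_char hs root_prod_XsubC mem_undup.
rewrite -fsbig_seq ?undup_uniq //.
apply: eq_bigr => x _.
by rewrite mu_prod_XsubC Monoid.iteropE iter_addr addr0.
Qed.

Lemma char_poly_conj (F : fieldType) n (P D : 'M[F]_n) :
  P \in unitmx -> char_poly (invmx P *m D *m P) = char_poly D.
Proof.
move=> Pu; rewrite /char_poly /char_poly_mx.
have VP : map_mx (@polyC F) (invmx P) *m map_mx (@polyC F) P = 1%:M.
  by rewrite -map_mxM mulVmx // map_mx1.
rewrite !map_mxM /= -[RHS]mul1r -(det1 _ n) -VP det_mulmx mulrAC -!det_mulmx.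
by rewrite mulmxBr mulmxBl scalar_mxC -[X in _ = \det (X - _)]mulmxA VP mulmx1.
Qed.

Lemma char_poly_diag_mx (F : fieldType) n (d : 'rV[F]_n) :
  char_poly (diag_mx d) = \prod_(i < n) ('X - (d 0 i)%:P).
Proof.
rewrite char_poly_trig ?diag_mx_is_trig //.
by apply: eq_bigr => i _; rewrite mxE eqxx mulr1n.
Qed.

Lemma real_AMGM (C : numClosedFieldType) (s t : C) :
  s \is Num.real -> 0 < t -> s <= (t * s ^+ 2 + t^-1) / 2.
Proof.
move=> sr t0; rewrite ler_pdivlMr ?ltr0n // -subr_ge0.
have -> : t * s ^+ 2 + t^-1 - s * 2 = t^-1 * (t * s - 1) ^+ 2.
  by field; rewrite gt_eqF.
rewrite mulr_ge0 ?invr_ge0 ?(ltW t0) // real_exprn_even_ge0 //.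
by rewrite rpredB ?rpredM ?rpred1 // gtr0_real.
Qed.

(** [S] keeps the eigenvectors of [A] and replaces each eigenvalue by its sign. It is Hermitian with
    square 1, which makes its rows unit vectors. *)
Lemma sum_abs_spectral_diag (C : numClosedFieldType) n (A : 'M[C]_n) :
  A \is hermsymmx ->
  exists S : 'M[C]_n,
    [/\ forall i j, `|S i j| = `|S j i|, forall i, \sum_j `|S i j| ^+ 2 = 1 &
        \sum_i `|spectral_diag A 0 i| = \sum_i \sum_j S i j * A j i].
Proof.
move=> Ah; have An := hermitian_normalmx Ah.
have dr := hermitian_spectral_diag_real Ah.
set P := spectralmx A; set d := spectral_diag A.
have AE : A = invmx P *m diag_mx d *m P by exact/orthomx_spectralP.
have Pu : P \in unitmx := spectral_unit A.
(* Zero eigenvalues get sign 1, so that [S *m S = 1] even when [A] is singular. *)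
pose sg : 'rV[C]_n := \row_i (if 0 <= d 0 i then 1 else -1).
pose S := invmx P *m diag_mx sg *m P.
have Sh i j : S j i = (S i j)^*.
  have ST : S = map_mx Num.conj S^T.
    have PV : invmx P = map_mx Num.conj P^T.
      by rewrite invmx_unitary ?spectral_unitarymx.
    rewrite /S PV !trmx_mul !map_mxM /= trmxCK tr_diag_mx map_diag_mx.
    rewrite mulmxA.
    congr (_ *m diag_mx _ *m _); apply/rowP => a; rewrite !mxE.
    by case: ifP => _; rewrite ?rmorphN rmorph1.
  by rewrite {1}ST !mxE.
have SS : S *m S = 1%:M.
  rewrite /S !mulmxA mulmxK // -(mulmxA (invmx P)) mulmx_diag.
  rewrite (_ : diag_mx _ = 1%:M) ?mulmx1 ?mulVmx //.
  apply/matrixP => i j; rewrite !mxE; case: ifP => _;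
  by rewrite ?mulrNN mulr1.
exists S; split => [i j|i|].
- by rewrite Sh norm_conjC.
- have := congr1 (fun M : 'M[C]_n => M i i) SS; rewrite !mxE eqxx mulr1n => <-.
  by apply: eq_bigr => j _; rewrite (Sh i j) normCK.
- have -> : \sum_i \sum_j S i j * A j i = \tr (S *m A).
    by rewrite /mxtrace; apply: eq_bigr => i _; rewrite mxE.
  rewrite {1}AE /S !mulmxA mulmxK // -(mulmxA (invmx P)) mulmx_diag.
  rewrite mxtrace_mulC mulmxA mulmxV // mul1mx mxtrace_diag.
  apply: eq_bigr => i _; rewrite !mxE.
  have dir : d 0 i \is Num.real by apply/mxOverP.
  case: ifP => h; first by rewrite ger0_norm ?mul1r.
  by rewrite ler0_norm ?mulN1r // ltW // real_ltNge // h.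
Qed.

Lemma hermsym_rel_mx (C : numClosedFieldType) n (e : rel 'I_n) :
  symmetric e -> (\matrix_(i, j) (e i j)%:R : 'M[C]_n) \is hermsymmx.
Proof.
move=> esym; apply/is_hermitianmxP; rewrite expr0 scale1r.
by apply/matrixP => i j; rewrite !mxE rmorph_nat esym.
Qed.

(** AM-GM is applied with [t = x i + x j]. By symmetry of [|S i j|], the two halves of the quadratic
    part agree, and the unit rows of [S] bound their common value by [\sum_i x i]. *)
Lemma sum_abs_spectral_diag_le (C : numClosedFieldType) n (e : rel 'I_n)
    (x : 'I_n -> C) :
  symmetric e -> (forall i, 0 < x i) ->
  \sum_i `|spectral_diag (\matrix_(i, j) (e i j)%:R : 'M[C]_n) 0 i| <=
    \sum_i x i + (\sum_i \sum_(j | e i j) (x i + x j)^-1) / 2.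
Proof.
move=> esym x0; set A : 'M[C]_n := \matrix_(i, j) (e i j)%:R.
have Ah : A \is hermsymmx := hermsym_rel_mx C esym.
have [S [Ssym Srow Sd]] := sum_abs_spectral_diag Ah.
rewrite -[leLHS]ger0_norm ?sumr_ge0 // Sd.
have -> : \sum_i \sum_j S i j * A j i = \sum_i \sum_(j | e i j) S i j.
  apply: eq_bigr => i _; rewrite [RHS]big_mkcond /=; apply: eq_bigr => j _.
  by rewrite mxE esym; case: (e i j); rewrite ?mulr1 ?mulr0.
apply: le_trans (ler_norm_sum _ _ _) _.
apply: (@le_trans _ _ (\sum_i \sum_(j | e i j)
    ((x i + x j) * `|S i j| ^+ 2 + (x i + x j)^-1) / 2)).
  apply: ler_sum => i _; apply: le_trans (ler_norm_sum _ _ _) _.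
  apply: ler_sum => j _; apply: real_AMGM; first exact: normr_real.
  exact: addr_gt0.
have -> : \sum_i \sum_(j | e i j)
    ((x i + x j) * `|S i j| ^+ 2 + (x i + x j)^-1) / 2 =
  \sum_i \sum_(j | e i j) x i * `|S i j| ^+ 2 +
    (\sum_i \sum_(j | e i j) (x i + x j)^-1) / 2.
  have sw : \sum_i \sum_(j | e i j) x j * `|S i j| ^+ 2 =
      \sum_i \sum_(j | e i j) x i * `|S i j| ^+ 2.
    rewrite (exchange_big_dep predT) //=; apply: eq_bigr => i _.
    by apply: eq_big => [j|j _]; rewrite 1?esym 1?Ssym.
  apply: (@mulIf _ 2); first by rewrite pnatr_eq0.
  rewrite mulrDl mulfVK ?pnatr_eq0 // [in RHS]mulr_natr.
  rewrite [X in _ = X + _]mulr2n -{2}sw.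
  rewrite mulr_suml -!big_split /=; apply: eq_bigr => i _.
  rewrite mulr_suml -!big_split /=; apply: eq_bigr => j _.
  by rewrite mulfVK ?pnatr_eq0 // mulrDl.
rewrite lerD2r; apply: ler_sum => i _.
rewrite -mulr_sumr -[leRHS]mulr1 ler_pM2l // -(Srow i) [leLHS]big_mkcond /=.
by apply: ler_sum => j _; case: ifP => // _; rewrite exprn_ge0.
Qed.

(** The spectral theorem is used over [R[i]]. There the eigenvalues are real because the matrix is
    Hermitian, so the factorization of the characteristic polynomial descends to [R]. *)
Lemma energy_le (R : realType) n (G : sgraph n) (x : 'I_n -> R) :
  (forall i, 0 < x i) ->
  energy R G <=
    \sum_i x i + (\sum_i \sum_(j | adj G i j) (x i + x j)^-1) / 2.
Proof.
move=> x0; have /andP[_ /forallP symG] := edges_simple G.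
have adjC : symmetric (adj G).
  by move=> i j; apply/eqP; exact: (forallP (symG i) j).
set C := R[i]; pose f : {rmorphism R -> C} := real_complex R.
pose A : 'M[C]_n := \matrix_(i, j) (adj G i j)%:R.
have AE : A = map_mx f (adjacency_matrix R G).
  by apply/matrixP => i j; rewrite !mxE rmorph_nat.
have Ah : A \is hermsymmx := hermsym_rel_mx C adjC.
have dr i : exists r, spectral_diag A 0 i == f r.
  have /mxOverP/(_ 0 i) := hermitian_spectral_diag_real Ah.
  by move=> /complex_realP[r ->]; exists r.
pose r i := xchoose (dr i).
have rE i : spectral_diag A 0 i = f (r i) by apply/eqP/(xchooseP (dr i)).
have chA : char_poly (adjacency_matrix R G) =
    \prod_(y <- [seq r i | i <- enum 'I_n]) ('X - y%:P).
  apply: (map_poly_inj f); rewrite map_char_poly -AE.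
  have /orthomx_spectralP {1}-> := hermitian_normalmx Ah.
  rewrite char_poly_conj ?spectral_unit // char_poly_diag_mx big_map big_enum /=.
  rewrite rmorph_prod; apply: eq_bigr => i _.
  by rewrite rmorphB /= map_polyX map_polyC /= rE.
rewrite (energy_split chA) big_map big_enum /=.
rewrite -lecR; have := @sum_abs_spectral_diag_le C n (adj G) (f \o x) adjC.
have x0C i : 0 < (f \o x) i by rewrite /= ltcR.
move=> /(_ x0C); rewrite (eq_bigr (fun i => f `|r i|)); last first.
  by move=> i _; rewrite rE /= normc_def /= expr0n addr0 sqrtr_sqr.
rewrite -(rmorph_sum f) => /le_trans; apply.
rewrite -[leRHS]/(f _) rmorphD fmorph_div rmorph_nat !rmorph_sum lerD2l /=.
rewrite ler_pM2r ?invr_gt0 ?ltr0n //; apply: ler_sum => i _.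
rewrite rmorph_sum; apply: ler_sum => j _.
by rewrite fmorphV rmorphD.
Qed.

(** * The growth step and the law of the tree *)

(** The graphs that the attachment process can reach, probabilities aside; [law_grown] shows that
    they carry all the mass. *)
Inductive grown : forall n, sgraph n -> Prop :=
| grown_edge2 : grown edge2
| grown_add_leaf n (G : sgraph n) v : grown G -> grown (add_leaf G v).

Section AddLeaf.
Variables (n : nat) (G : sgraph n).

Lemma adj_sym : symmetric (adj G).
Proof.
have /andP[_ /forallP symG] := edges_simple G.
by move=> i j; apply/eqP; exact: (forallP (symG i) j).
Qed.

Lemma adj_irr i : adj G i i = false.
Proof.
by have /andP[/forallP irr _] := edges_simple G; apply/negbTE/irr.
Qed.

Lemma adj_add_leaf v i j :
  adj (add_leaf G v) (lift ord_max i) (lift ord_max j) = adj G i j.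
Proof. by rewrite /adj /= ffunE /= !liftK. Qed.

Lemma adj_add_leaf_maxr v i :
  adj (add_leaf G v) (lift ord_max i) ord_max = (i == v).
Proof. by rewrite /adj /= ffunE /= liftK unlift_none. Qed.

Lemma adj_add_leaf_maxl v i :
  adj (add_leaf G v) ord_max (lift ord_max i) = (i == v).
Proof. by rewrite /adj /= ffunE /= liftK unlift_none. Qed.

Lemma degreeE v : degree G v = (\sum_j adj G v j)%N.
Proof.
by rewrite /degree -sum1_card big_mkcond; apply: eq_bigr => j _; rewrite inE.
Qed.
End AddLeaf.

Lemma degree_add_leaf n (G : sgraph n) v i :
  degree (add_leaf G v) (lift ord_max i) = (degree G i + (i == v))%N.
Proof.
rewrite !degreeE (bigD1_ord ord_max) //= adj_add_leaf_maxr addnC; congr addn.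
by apply: eq_bigr => j _; rewrite adj_add_leaf.
Qed.

Lemma degree_add_leaf_max n (G : sgraph n) v :
  degree (add_leaf G v) ord_max = 1%N.
Proof.
rewrite degreeE (bigD1_ord ord_max) //= adj_irr add0n.
rewrite (eq_bigr (fun j => (j == v : nat))) => [|j _]; last first.
  by rewrite adj_add_leaf_maxl.
by rewrite (bigD1 v) //= eqxx big1 ?addn0 // => j /negbTE->.
Qed.

Lemma add_leaf_inj n :
  injective (fun p : sgraph n * 'I_n => add_leaf p.1 p.2).
Proof.
move=> [G v] [H w] /= e; congr pair.
  apply/val_inj/ffunP => -[i j].
  by have := adj_add_leaf G v i j; rewrite e adj_add_leaf.
have := adj_add_leaf_maxr G v v; rewrite e adj_add_leaf_maxr eqxx.
by move/eqP.
Qed.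

Lemma degree_edge2 v : degree edge2 v = 1%N.
Proof.
rewrite degreeE !big_ord_recl big_ord0 /adj !ffunE /=.
by case: v => -[|[|m]] hm.
Qed.

Lemma grown_degree_gt0 n (G : sgraph n) v : grown G -> (0 < degree G v)%N.
Proof.
move=> g; elim: g v => [|m H w _ IH] v; first by rewrite degree_edge2.
case: (unliftP ord_max v) => [i ->|->]; last by rewrite degree_add_leaf_max.
by rewrite degree_add_leaf ltn_addr.
Qed.

Lemma grown_gt1 n (G : sgraph n) : grown G -> (1 < n)%N.
Proof. by elim=> // m H w _ IH; apply: ltnW. Qed.

(** Each attached leaf raises the degree sum by 2. This makes the attachment probabilities sum to
    1. *)
Lemma grown_sum_degree n (G : sgraph n) :
  grown G -> (\sum_v degree G v = n.-1.*2)%N.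
Proof.
elim=> [|m H w gH IH].
  rewrite (eq_bigr (fun=> 1%N)) => [|v _]; last by rewrite degree_edge2.
  by rewrite sum1_card card_ord.
rewrite (bigD1_ord ord_max) //= degree_add_leaf_max.
rewrite (eq_bigr (fun i => degree H i + (i == w))%N) => [|i _]; last first.
  by rewrite degree_add_leaf.
rewrite big_split /= IH (bigD1 w) //= eqxx big1 => [|j /negbTE->//].
have := grown_gt1 gH; case: m {H w gH IH} => // m _.
by rewrite doubleS /= addn0 add1n addn1.
Qed.

(** Since [h] is injective, [b] dominates the push-forward of [a]; the excess [c] is nonnegative
    with total 0, hence vanishes everywhere. *)
Lemma sum_transport (R : realType) (I J : finType) (h : I -> J)
    (a : I -> R) (b f : J -> R) :
  injective h -> (forall j, 0 <= b j) -> (forall i, a i <= b (h i)) ->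
  \sum_i a i = \sum_j b j ->
  \sum_j b j * f j = \sum_i a i * f (h i).
Proof.
move=> hinj b0 ab sab; pose c j := b j - \sum_(i | h i == j) a i.
have c0 j : 0 <= c j.
  rewrite subr_ge0; case: (pickP (fun i => h i == j)) => [i /eqP <-|no].
    by rewrite (big_pred1 i) // => k; rewrite (inj_eq hinj).
  by rewrite big_pred0.
have sc : \sum_j c j = 0.
  rewrite sumrB -sab [X in _ - X](_ : _ = \sum_i a i) ?subrr //.
  by rewrite [RHS](partition_big h predT).
have bE j : b j = \sum_(i | h i == j) a i.
  apply/eqP; rewrite -subr_eq0.
  have /eqP := sc; rewrite psumr_eq0 // => /allP/(_ j).
  by rewrite mem_index_enum; apply.
rewrite [RHS](partition_big h predT) //=; apply: eq_bigr => j _.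
by rewrite bE mulr_suml; apply: eq_bigr => i /eqP->.
Qed.

Definition vert_sum (R : realType) (g : nat -> R) n (G : sgraph n) : R :=
  \sum_v g (degree G v).

Definition edge_sum (R : realType) (f : nat -> nat -> R) n (G : sgraph n) : R :=
  \sum_u \sum_(v | adj G u v) f (degree G u) (degree G v).

Lemma vert_sum_add_leaf (R : realType) (g : nat -> R) n (G : sgraph n) w :
  vert_sum g (add_leaf G w) - vert_sum g G =
    g (degree G w).+1 - g (degree G w) + g 1%N.
Proof.
rewrite /vert_sum (bigD1_ord ord_max) //= degree_add_leaf_max.
rewrite -addrA addrC -sumrB; congr (_ + _).
rewrite (bigD1 w) //= degree_add_leaf eqxx addn1.
rewrite big1 ?addr0 // => i /negbTE iw.
by rewrite degree_add_leaf iw addn0 subrr.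
Qed.

(** Only pairs through [w] change: those starting at [w], those ending at [w], and the new edge in
    both directions. *)
Lemma edge_sum_add_leaf (R : realType) (f : nat -> nat -> R) n (G : sgraph n) w :
  edge_sum f (add_leaf G w) - edge_sum f G =
    \sum_(v | adj G w v) (f (degree G w).+1 (degree G v) -
                          f (degree G w) (degree G v)) +
    \sum_(v | adj G w v) (f (degree G v) (degree G w).+1 -
                          f (degree G v) (degree G w)) +
    (f (degree G w).+1 1%N + f 1%N (degree G w).+1).
Proof.
pose d := degree G; pose d' (i : 'I_n) := (d i + (i == w))%N.
have rowE i : \sum_(v | adj (add_leaf G w) (lift ord_max i) v)
      f (d' i) (degree (add_leaf G w) v) =
    (if i == w then f (d i).+1 1%N else 0) +
    \sum_(v | adj G i v) f (d' i) (d' v).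
  rewrite big_mkcond (bigD1_ord ord_max) //= adj_add_leaf_maxr.
  rewrite degree_add_leaf_max /d'; congr (_ + _).
    by case: eqP => // ->; rewrite addn1.
  rewrite [RHS]big_mkcond /=; apply: eq_bigr => j _.
  by rewrite adj_add_leaf degree_add_leaf.
have -> : edge_sum f (add_leaf G w) =
    (f (d w).+1 1%N + f 1%N (d w).+1) + \sum_u \sum_(v | adj G u v) f (d' u) (d' v).
  rewrite /edge_sum (bigD1_ord ord_max) //= addrC.
  under eq_bigr => i _ do rewrite degree_add_leaf rowE.
  rewrite big_split /= -big_mkcond big_pred1_eq -!addrA [X in _ = _ + X]addrC.
  congr (_ + (_ + _)).
  rewrite big_mkcond (bigD1_ord ord_max) //= adj_irr add0r (bigD1 w) //=.
  rewrite adj_add_leaf_maxl eqxx degree_add_leaf eqxx degree_add_leaf_max addn1.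
  rewrite big1 ?addr0 // => i /negbTE iw.
  by rewrite adj_add_leaf_maxl iw.
rewrite -addrA addrC; congr (_ + _); rewrite -sumrB.
(* Without loops at most one endpoint of a pair is [w], so the two corrections never overlap. *)
transitivity (\sum_u
    ((if u == w then \sum_(v | adj G u v) (f (d w).+1 (d v) - f (d w) (d v))
      else 0) +
     \sum_(v | adj G u v)
       (if v == w then f (d u) (d w).+1 - f (d u) (d w) else 0))).
  apply: eq_bigr => u _; rewrite -sumrB.
  case: eqVneq => [->|uw].
    rewrite -big_split /=; apply: eq_bigr => v wv.
    have vw : (v == w) = false.
      by apply/eqP => vw; rewrite vw adj_irr in wv.
    by rewrite vw addr0 /d' eqxx vw addn0 addn1.
  rewrite add0r; apply: eq_bigr => v uv; rewrite /d' (negbTE uw) addn0.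
  by case: eqP => [->|_]; rewrite ?addn1 // addn0 subrr.
rewrite big_split /= -big_mkcond big_pred1_eq; congr (_ + _).
rewrite (exchange_big_dep predT) //= (bigD1 w) //= [X in _ + X]big1 ?addr0.
  by apply: eq_big => [v|v _]; rewrite ?eqxx // adj_sym.
by move=> v /negbTE vw; rewrite big1 // => u _; rewrite vw.
Qed.

Section Law.
Variables (R : realType) (d : measure_display) (Omega : measurableType d).
Variables (P : probability Omega R) (T : forall n : nat, Omega -> sgraph n).
Hypothesis hT : barabasi_albert P T.

Definition law n (G : sgraph n) : R := fine (P [set w | T n w = G]).
Definition mean n (f : sgraph n -> R) : R := \sum_G law G * f G.

Lemma prob_pred n (A : pred (sgraph n)) :
  P [set w | A (T n w)] = (\sum_(G | A G) law G)%:E.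
Proof.
have fin G : (P [set w | T n w = G] \is a fin_num)%E.
  by apply: fin_num_measure; exact: (ba_measurable hT).
rewrite (_ : [set w | A (T n w)] =
    \big[setU/set0]_(G <- enum A) [set w | T n w = G]); last first.
  rewrite -bigcup_seq; apply/seteqP; split => w /=.
    by move=> h; exists (T n w) => //=; rewrite mem_enum.
  by move=> [G /= + ->]; rewrite mem_enum.
rewrite fsbig_seq ?enum_uniq // measure_fsbig //.
- rewrite -fsbig_seq ?enum_uniq // big_enum /= -sumEFin.
  by apply: eq_bigr => G _; rewrite fineK.
- by move=> G _; exact: (ba_measurable hT).
- by move=> G H _ _ [w [/= -> ->]].
Qed.

Lemma law_ge0 n (G : sgraph n) : 0 <= law G.
Proof. exact: fine_ge0. Qed.

Lemma law_sum n : \sum_(G : sgraph n) law G = 1.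
Proof.
apply: EFin_inj; rewrite -(@prob_pred n predT) /=.
rewrite (_ : [set w | _] = setT) ?probability_setT //.
by apply/seteqP; split.
Qed.

Lemma law_add_leaf n (G : sgraph n) v : (1 < n)%N ->
  law G * ((degree G v)%:R / (2 * (n%:R - 1))) <= law (add_leaf G v).
Proof.
move=> n1.
rewrite -lee_fin /law EFinM !fineK -?ba_step //; last 2 first.
  by apply: fin_num_measure; exact: (ba_measurable hT).
  by apply: fin_num_measure; exact: (ba_measurable hT).
apply: le_measure; rewrite ?inE; last by move=> w [].
  by apply: measurableI; exact: (ba_measurable hT).
exact: (ba_measurable hT).
Qed.

Lemma law_edge2 : law edge2 = 1.
Proof. by rewrite /law (ba_init hT). Qed.

(** For a grown graph the attachment probabilities sum to 1 by the degree sum; any other graph has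
    mass 0. *)
Lemma law_sum_add_leaf n : (1 < n)%N ->
  (forall G : sgraph n, law G != 0 -> grown G) ->
  \sum_(p : sgraph n * 'I_n)
    law p.1 * ((degree p.1 p.2)%:R / (2 * (n%:R - 1))) =
  \sum_(H : sgraph n.+1) law H.
Proof.
move=> n1 supp; rewrite law_sum -[RHS](law_sum n).
transitivity (\sum_(G : sgraph n) \sum_v
    law G * ((degree G v)%:R / (2 * (n%:R - 1)))); first by rewrite pair_bigA.
apply: eq_bigr => G _; rewrite -mulr_sumr -mulr_suml -natr_sum.
have [->|/supp gG] := eqVneq (law G) 0; first by rewrite mul0r.
rewrite (grown_sum_degree gG) -muln2 natrM mulrC -subn1 natrB ?(ltnW n1) //.
rewrite (mulrC 2) divff ?mul1r // mulf_eq0 pnatr_eq0 orbF subr_eq0.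
by rewrite -[1]/(1%:R) eqr_nat gtn_eqF.
Qed.

(* [law_add_leaf] only bounds the law of T n.+1 from below, since a graph might
   also arise outside the attachment rule; equality comes from the total mass. *)
Lemma law_transport n (f : sgraph n.+1 -> R) : (1 < n)%N ->
  (forall G : sgraph n, law G != 0 -> grown G) ->
  mean f = \sum_(p : sgraph n * 'I_n)
    law p.1 * ((degree p.1 p.2)%:R / (2 * (n%:R - 1))) * f (add_leaf p.1 p.2).
Proof.
move=> n1 supp; apply: (sum_transport f (@add_leaf_inj n)).
- exact: law_ge0.
- by move=> p; exact: law_add_leaf.
- exact: law_sum_add_leaf.
Qed.

(** Induction on [n]: the support hypothesis of [law_transport] at one size is the induction
    hypothesis, and its conclusion controls the next size. *)
Lemma law_grown n (G : sgraph n) : (1 < n)%N -> law G != 0 -> grown G.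
Proof.
move=> n1; rewrite -(subnKC n1) in G *; elim: (n - 2)%N G => [|m IH] G.
  rewrite addn0 in G *; have [-> _|GN] := eqVneq G edge2; first exact: grown_edge2.
  have := law_sum 2; rewrite (bigD1 edge2) //= law_edge2 => /eqP.
  rewrite -subr_eq0 addrC addrK psumr_eq0; last by move=> H _; exact: law_ge0.
  move=> /allP/(_ G); rewrite mem_index_enum GN /= => /(_ isT)/eqP->.
  by rewrite eqxx.
rewrite addnS in G * => GN.
case: (pickP (fun p : sgraph (2 + m) * 'I_(2 + m) =>
    (add_leaf p.1 p.2 == G) && (law p.1 != 0)))
  => [[H v] /= /andP[/eqP<- /IH gH]|no].
  exact: grown_add_leaf.
(* The test function is the indicator of [G], whose mean is [law G]; every term on the other side
   vanishes. *)
have := @law_transport (2 + m) (fun H => (H == G)%:R) isT IH.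
rewrite /mean (bigD1 G) //= eqxx mulr1 big1 ?addr0; last first.
  by move=> H /negbTE->; rewrite mulr0.
rewrite big1 => [G0|p _]; first by rewrite G0 eqxx in GN.
have := no p; case: eqP => /= _; last by rewrite mulr0.
by move=> /negbFE/eqP->; rewrite !mul0r.
Qed.

(** Tower property: conditionally on the tree at time [n], [f] is averaged over the attachment
    vertex with weights proportional to the degree. *)
Lemma mean_add_leaf n (f : sgraph n.+1 -> R) : (1 < n)%N ->
  mean f = mean (fun G : sgraph n =>
    (\sum_v (degree G v)%:R * f (add_leaf G v)) / (2 * (n%:R - 1))).
Proof.
move=> n1; rewrite law_transport //; last by move=> G; exact: law_grown.
transitivity (\sum_(G : sgraph n) \sum_v
    law G * ((degree G v)%:R / (2 * (n%:R - 1))) * f (add_leaf G v)).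
  by rewrite pair_bigA.
apply: eq_bigr => G _; rewrite mulr_suml mulr_sumr; apply: eq_bigr => v _.
by rewrite -mulrA mulrAC.
Qed.

Lemma mean_grown n (f g : sgraph n -> R) : (1 < n)%N ->
  (forall G, grown G -> f G = g G) -> mean f = mean g.
Proof.
move=> n1 fg; apply: eq_bigr => G _.
have [->|/(law_grown n1)/fg ->//] := eqVneq (law G) 0; by rewrite !mul0r.
Qed.

Lemma le_mean n (f g : sgraph n -> R) : (1 < n)%N ->
  (forall G, grown G -> f G <= g G) -> mean f <= mean g.
Proof.
move=> n1 fg; apply: ler_sum => G _.
have [->|/(law_grown n1)/fg ?] := eqVneq (law G) 0; first by rewrite !mul0r.
by rewrite ler_wpM2l ?law_ge0.
Qed.

Lemma meanD n (f g : sgraph n -> R) :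
  mean (fun G => f G + g G) = mean f + mean g.
Proof. by rewrite -big_split; apply: eq_bigr => G _; rewrite mulrDr. Qed.

Lemma meanZ n a (f : sgraph n -> R) : mean (fun G => a * f G) = a * mean f.
Proof. by rewrite mulr_sumr; apply: eq_bigr => G _; rewrite mulrCA. Qed.

Lemma mean_cst n a : mean (fun G : sgraph n => a) = a.
Proof. by rewrite /mean -mulr_suml law_sum mul1r. Qed.

(** * Laws of large numbers with second moment bounds *)

(** Centring at [c * (n - 1)] instead of [c * n] matches the degree sum [2 * (n - 1)], which makes
    the drift identities exact. *)
Definition lln (X : forall n, sgraph n -> R) (c : R) :=
  exists A, forall n, (1 < n)%N ->
    mean (fun G : sgraph n => (X n G - c * (n%:R - 1)) ^+ 2) <= A * (n%:R - 1).

Lemma eq_lln (X Y : forall n, sgraph n -> R) c :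
  (forall n (G : sgraph n), grown G -> X n G = Y n G) -> lln X c -> lln Y c.
Proof.
move=> XY [A hA]; exists A => n n1; apply: le_trans (hA n n1).
by apply: le_mean => // G gG; rewrite XY.
Qed.

Lemma lln_linear (X Y : forall n, sgraph n -> R) a c e :
  lln X c -> lln Y e -> lln (fun n G => a * X n G + Y n G) (a * c + e).
Proof.
move=> [A hA] [B hB]; exists (2 * a ^+ 2 * A + 2 * B) => n n1.
apply: (@le_trans _ _ (mean (fun G : sgraph n =>
    2 * a ^+ 2 * (X n G - c * (n%:R - 1)) ^+ 2 +
    2 * (Y n G - e * (n%:R - 1)) ^+ 2))).
  apply: le_mean => // G _; set N := n%:R - 1.
  (* This square gives [(s + t) ^+ 2 <= 2 * s ^+ 2 + 2 * t ^+ 2]. *)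
  have := sqr_ge0 (a * (X n G - c * N) - (Y n G - e * N)); nra.
rewrite meanD !meanZ [leRHS]mulrDl.
have := hA n n1; have := hB n n1; set N := n%:R - 1 => hb ha.
by rewrite lerD // -[leRHS]mulrA ler_wpM2l // mulr_ge0 ?sqr_ge0.
Qed.

Lemma lln_deterministic (X : forall n, sgraph n -> R) c b :
  (forall n (G : sgraph n), grown G -> X n G = c * (n%:R - 1) + b) -> lln X c.
Proof.
move=> XE; exists (b ^+ 2) => n n1.
rewrite (@mean_grown n _ (fun=> b ^+ 2)) //; last first.
  by move=> G gG; rewrite XE // addrAC subrr add0r.
rewrite mean_cst ler_peMr ?sqr_ge0 // lerBrDr.
by rewrite -[1 + 1]/(2%:R) ler_nat.
Qed.

Lemma lln_sum I (s : seq I) (X : I -> forall n, sgraph n -> R) (a c : I -> R) :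
  (forall i, lln (X i) (c i)) ->
  lln (fun n G => \sum_(i <- s) a i * X i n G) (\sum_(i <- s) a i * c i).
Proof.
move=> h; elim: s => [|i s IH].
  rewrite big_nil; apply: (@lln_deterministic _ 0 0) => n G _.
  by rewrite big_nil mul0r addr0.
rewrite big_cons; apply: eq_lln (lln_linear (a i) (h i) IH) => n G _.
by rewrite big_cons.
Qed.

Lemma grown_sum_degreeR n (G : sgraph n) : grown G ->
  \sum_v (degree G v)%:R = 2 * (n%:R - 1) :> R.
Proof.
move=> gG; rewrite -natr_sum grown_sum_degree // -muln2 natrM mulrC -subn1.
by rewrite natrB // ltnW // (grown_gt1 gG).
Qed.

(* With Z := X - c (n - 1), the hypothesis on c makes the mean of the next Z
   equal to Z + (a1 Z1 + a2 Z2 - b Z) / (2 (n - 1)); the damping term -b Z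
   absorbs the cross terms of the second moment. *)
Lemma lln_step (X X1 X2 : forall n, sgraph n -> R) (a1 a2 b c c1 c2 C : R) :
  0 < b -> lln X1 c1 -> lln X2 c2 -> (2 + b) * c = a1 * c1 + a2 * c2 ->
  (forall n (G : sgraph n) w, grown G ->
    `|X n.+1 (add_leaf G w) - X n G| <= C) ->
  (forall n (G : sgraph n), grown G ->
    \sum_w (degree G w)%:R * (X n.+1 (add_leaf G w) - X n G) =
    a1 * X1 n G + a2 * X2 n G - b * X n G) ->
  lln X c.
Proof.
move=> b0 [A1 h1] [A2 h2] cE XC XD.
pose Z n (G : sgraph n) := X n G - c * (n%:R - 1).
pose Z1 n (G : sgraph n) := X1 n G - c1 * (n%:R - 1).
pose Z2 n (G : sgraph n) := X2 n G - c2 * (n%:R - 1).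
(* [B] bounds the one-step growth of the second moment of [Z]: two terms from the driving
   quantities, one from the squared increments. *)
pose B := a1 ^+ 2 / (2 * b) * A1 + a2 ^+ 2 / (2 * b) * A2 + (C + `|c|) ^+ 2.
(* [A] dominates both the second moment at [n = 2], where [n - 1 = 1], and the growth [B] of each
   later step. *)
pose A := mean (fun G => Z 2%N G ^+ 2) + `|B|.
have step n : (1 < n)%N ->
    mean (fun G => Z n.+1 G ^+ 2) <= mean (fun G => Z n G ^+ 2) + B.
  move=> n1; set N : R := n%:R - 1.
  have N0 : 0 < N by rewrite subr_gt0 ltr1n.
  rewrite mean_add_leaf //.
  apply: (@le_trans _ _ (mean (fun G : sgraph n => Z n G ^+ 2 +
     (a1 ^+ 2 / (2 * b) / N * Z1 n G ^+ 2 +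
     (a2 ^+ 2 / (2 * b) / N * Z2 n G ^+ 2 + (C + `|c|) ^+ 2))))).
    apply: le_mean => // G gG; rewrite -/N.
    have sumd := grown_sum_degreeR gG; rewrite -/N in sumd.
    pose D w := X n.+1 (add_leaf G w) - X n G.
    have ZE w : Z n.+1 (add_leaf G w) = Z n G + (D w - c).
      by rewrite /Z /D -natr1; ring.
    rewrite (eq_bigr (fun w => Z n G ^+ 2 * (degree G w)%:R +
       2 * Z n G * ((degree G w)%:R * D w - c * (degree G w)%:R) +
       (degree G w)%:R * (D w - c) ^+ 2)) => [|w _]; last by rewrite ZE; ring.
    rewrite !big_split /= -!mulr_sumr sumrB -mulr_sumr sumd XD //.
    have -> : a1 * X1 n G + a2 * X2 n G - b * X n G - c * (2 * N) =
        a1 * Z1 n G + a2 * Z2 n G - b * Z n G.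
      transitivity (a1 * Z1 n G + a2 * Z2 n G - b * Z n G +
          N * (a1 * c1 + a2 * c2 - (2 + b) * c)).
        by rewrite /Z /Z1 /Z2 -/N; ring.
      by rewrite cE subrr mulr0 addr0.
    have s3 : \sum_w (degree G w)%:R * (D w - c) ^+ 2 <=
        (C + `|c|) ^+ 2 * (2 * N).
      rewrite -sumd mulr_sumr; apply: ler_sum => w _.
      rewrite mulrC ler_wpM2r // -[leLHS]real_normK ?num_real //.
      rewrite ler_sqr ?nnegrE // ?addr_ge0 //; last first.
        by apply: le_trans (XC n G w gG).
      by apply: le_trans (ler_normB _ _) _; rewrite lerD2r XC.
    have N2 : 0 < 2 * N by rewrite mulr_gt0.
    rewrite ler_pdivrMr //.
    move: (Z n G) (Z1 n G) (Z2 n G) => z z1 z2.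
    (* Each of the two cross terms is completed to a square with half of the damping
       [b * z ^+ 2]. *)
    have key : z * (a1 * z1 + a2 * z2 - b * z) <=
        a1 ^+ 2 / (2 * b) * z1 ^+ 2 + a2 ^+ 2 / (2 * b) * z2 ^+ 2.
      rewrite -subr_ge0.
      have -> : a1 ^+ 2 / (2 * b) * z1 ^+ 2 + a2 ^+ 2 / (2 * b) * z2 ^+ 2 -
          z * (a1 * z1 + a2 * z2 - b * z) =
          ((a1 * z1 - b * z) ^+ 2 + (a2 * z2 - b * z) ^+ 2) / (2 * b).
        by field; rewrite gt_eqF.
      by rewrite divr_ge0 ?addr_ge0 ?sqr_ge0 ?mulr_ge0 // ltW.
    have -> : (z ^+ 2 + (a1 ^+ 2 / (2 * b) / N * z1 ^+ 2 +
        (a2 ^+ 2 / (2 * b) / N * z2 ^+ 2 + (C + `|c|) ^+ 2))) * (2 * N) =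
        z ^+ 2 * (2 * N) + 2 * (a1 ^+ 2 / (2 * b) * z1 ^+ 2 +
          a2 ^+ 2 / (2 * b) * z2 ^+ 2) + (C + `|c|) ^+ 2 * (2 * N).
      by field; rewrite !gt_eqF.
    rewrite lerD // lerD2l -mulrA ler_pM2l //.
  rewrite !meanD !meanZ mean_cst lerD2l /B addrA lerD2r.
  rewrite lerD // -mulrA ler_wpM2l ?divr_ge0 ?sqr_ge0 ?mulr_ge0 ?(ltW b0) //;
    by rewrite ler_pdivrMl // mulrC ?h1 ?h2.
exists A => n n1; rewrite -/(Z n); rewrite -(subnKC n1).
elim: (n - 2)%N => [|k IH].
  by rewrite addn0 [X in _ <= _ * X]addrK mulr1 ler_wpDr.
rewrite addnS; apply: le_trans (step _ _) _ => //.
rewrite -natr1 addrAC mulrDr mulr1 lerD // /A.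
apply: le_trans (ler_norm _) _; rewrite lerDr.
by apply: sumr_ge0 => G _; rewrite mulr_ge0 ?law_ge0 ?sqr_ge0.
Qed.

(** The count for [i.+1] grows exactly when the chosen vertex has degree [i.+1]. Weighted by degree,
    this gives the drift [i.+1] times the difference of consecutive tail counts. *)
Lemma lln_vert_tail i :
  lln (vert_sum (fun k => (i < k)%N%:R)) (2 / (i.+1%:R * i.+2%:R)).
Proof.
elim: i => [|i IH].
  apply: (@lln_deterministic _ _ 1) => n G gG.
  rewrite /vert_sum (eq_bigr (fun=> 1)) => [|v _]; last by rewrite grown_degree_gt0.
  by rewrite sumr_const card_ord mul1r divff // mul1r subrK.
apply: (@lln_step _ _ _ i.+1%:R 0 i.+1%:R _ _ _ 1 _ IH IH).
- by rewrite ltr0n.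
- by field; rewrite ?nat1r -?natrD !pnatr_eq0.
- move=> n G w _; rewrite vert_sum_add_leaf addr0.
  by do 2!case: ltnP => _; rewrite ?subrr ?subr0 ?sub0r ?normrN ?normr0 ?normr1.
- move=> n G gG; under eq_bigr => w _ do rewrite vert_sum_add_leaf addr0 ltnS.
  rewrite mul0r addr0 -mulrBr /vert_sum -sumrB mulr_sumr; apply: eq_bigr => w _.
  have [h|h|->] := ltngtP (degree G w) i.+1.
  - by rewrite /= subrr !mulr0.
  - by rewrite /= subrr !mulr0.
  - by rewrite /= subr0 !mulr1.
Qed.

(** A chosen vertex of degree [i.+1] enters the sum with [i.+2], and one of larger degree adds 1.
    The second effect lowers the damping from [i.+2] to [i.+1]. *)
Lemma lln_vert_tail_degree i :
  lln (vert_sum (fun k => k%:R * (i < k)%N%:R)) (4 / i.+2%:R).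
Proof.
elim: i => [|i IH].
  apply: (@lln_deterministic _ _ 0) => n G gG.
  have -> : 4 / 2 = 2 :> R by field.
  rewrite addr0 -(grown_sum_degreeR gG); apply: eq_bigr => v _.
  by rewrite grown_degree_gt0 // mulr1.
apply: (@lln_step _ _ _ i.+2%:R 0 i.+1%:R _ _ _ i.+2%:R _ IH IH).
- by rewrite ltr0n.
- by field; rewrite ?nat1r -?natrD !pnatr_eq0.
- move=> n G w _; rewrite vert_sum_add_leaf mulr0 addr0 ltnS.
  have [h|h|->] := ltngtP (degree G w) i.+1.
  - by rewrite /= !mulr0 subrr normr0 ler0n.
  - by rewrite /= !mulr1 -natr1 addrAC subrr add0r normr1 ler1n.
  - by rewrite /= mulr1 mulr0 subr0 ger0_norm.
- move=> n G gG.
  under eq_bigr => w _ do rewrite vert_sum_add_leaf mulr0 addr0 ltnS.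
  rewrite mul0r addr0 /vert_sum !mulr_sumr -sumrB; apply: eq_bigr => w _.
  have [h|h|->] := ltngtP (degree G w) i.+1.
  - by rewrite /= !mulr0 subrr mulr0.
  - by rewrite /= -!natr1; ring.
  - by rewrite /= -!natr1; ring.
Qed.

Definition edge_tail i j : nat -> nat -> R := fun k l => ((i < k) && (j < l))%N%:R.

(** For positive [i] and [j], the solution [L] of [(i + j + 2) L(i, j) = i L(i - 1, j) + j L(i, j -
    1)], symmetric, with [L(i, 0) = 4 / (i + 2)]. *)
Definition edge_lim i j : R :=
  4 / (i.+1%:R * j.+1%:R) - 4 / ((i + j).+1%:R * (i + j).+2%:R).

Lemma edge_sum_tailC i j n (G : sgraph n) :
  edge_sum (edge_tail i j) G = edge_sum (edge_tail j i) G.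
Proof.
rewrite /edge_sum (exchange_big_dep predT) //=; apply: eq_bigr => u _.
by apply: eq_big => [v|v _]; rewrite 1?adj_sym // /edge_tail andbC.
Qed.

Lemma edge_limC i j : edge_lim i j = edge_lim j i.
Proof. by rewrite /edge_lim (mulrC j.+1%:R) (addnC j). Qed.

(** All degrees are positive, so the inner sum counts all neighbours and the pair count becomes a
    degree sum. *)
Lemma lln_edge_tail0 i : lln (edge_sum (edge_tail i 0)) (edge_lim i 0).
Proof.
have -> : edge_lim i 0 = 4 / i.+2%:R.
  rewrite /edge_lim addn0; by field; rewrite ?nat1r -?natrD !pnatr_eq0.
apply: eq_lln (lln_vert_tail_degree i) => n G gG.
apply: eq_bigr => u _.
rewrite (eq_bigr (fun=> (i < degree G u)%N%:R)) => [|v _]; last first.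
  by rewrite /edge_tail grown_degree_gt0 // andbT.
by rewrite sumr_const mulr_natl /degree cardsE.
Qed.

Lemma edge_tail_succ i j n (G : sgraph n) w :
  \sum_(v | adj G w v) (edge_tail i.+1 j (degree G w).+1 (degree G v) -
                        edge_tail i.+1 j (degree G w) (degree G v)) =
  (degree G w == i.+1)%:R * \sum_(v | adj G w v) (j < degree G v)%N%:R.
Proof.
rewrite mulr_sumr; apply: eq_bigr => v _; rewrite /edge_tail ltnS.
by case: (ltngtP (degree G w) i.+1); rewrite /= ?subrr ?subr0 ?mul0r ?mul1r.
Qed.

(** The factor [degree G w] equals [i.+1] wherever the indicator is nonzero, and that indicator is a
    difference of two consecutive tails. *)
Lemma degree_edge_tail_succ i j n (G : sgraph n) :
  \sum_w (degree G w)%:R * ((degree G w == i.+1)%:R *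
     \sum_(v | adj G w v) (j < degree G v)%N%:R) =
  i.+1%:R * (edge_sum (edge_tail i j) G - edge_sum (edge_tail i.+1 j) G).
Proof.
rewrite /edge_sum -sumrB mulr_sumr; apply: eq_bigr => w _.
rewrite -sumrB !mulr_sumr; apply: eq_bigr => v _; rewrite /edge_tail.
by case: (ltngtP (degree G w) i.+1) => [_|_|->];
  rewrite /= ?subrr ?subr0 ?mul0r ?mul1r ?mulr0.
Qed.

Lemma edge_tail_succ_le i j n (G : sgraph n) w :
  0 <= ((degree G w == i.+1)%:R * \sum_(v | adj G w v) (j < degree G v)%N%:R : R)
    <= i.+1%:R.
Proof.
rewrite mulr_ge0 ?sumr_ge0 //=.
case: eqP => [<-|_]; last by rewrite mul0r.
rewrite mul1r /degree cardsE -sumr_const.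
by apply: ler_sum => v _; rewrite lern1 leq_b1.
Qed.

(** Double induction with [lln_edge_tail0] on both boundaries. Inside, a pair starts to count when
    its chosen endpoint crosses its threshold, which leads back to one index lowered by 1. *)
Lemma lln_edge_tail i j : lln (edge_sum (edge_tail i j)) (edge_lim i j).
Proof.
elim: i j => [|i IHi] j.
  rewrite edge_limC; apply: eq_lln (lln_edge_tail0 j) => n G _.
  exact: edge_sum_tailC.
elim: j => [|j IHj]; first exact: lln_edge_tail0.
have add_leafE n (G : sgraph n) w :
    edge_sum (edge_tail i.+1 j.+1) (add_leaf G w) -
      edge_sum (edge_tail i.+1 j.+1) G =
    (degree G w == i.+1)%:R * (\sum_(v | adj G w v) (j.+1 < degree G v)%N%:R) +
    (degree G w == j.+1)%:R * (\sum_(v | adj G w v) (i.+1 < degree G v)%N%:R).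
  (* The new edge contributes nothing: its leaf has degree 1, below both thresholds. *)
  rewrite edge_sum_add_leaf -!edge_tail_succ /edge_tail !andbF addr0 addr0.
  by congr (_ + _); apply: eq_bigr => v _; rewrite !(andbC (j.+1 < _)%N).
apply: (@lln_step _ _ _ i.+1%:R j.+1%:R (i.+1 + j.+1)%:R _ _ _ (i.+1 + j.+1)%:R
   _ (IHi j.+1) IHj).
- by rewrite ltr0n.
- rewrite /edge_lim !addnS !addSn.
  by field; rewrite ?nat1r -?natrD !pnatr_eq0.
- move=> n G w _; rewrite add_leafE natrD.
  have /andP[? ?] := edge_tail_succ_le i j.+1 G w.
  have /andP[? ?] := edge_tail_succ_le j i.+1 G w.
  by rewrite ger0_norm ?addr_ge0 ?lerD.
- move=> n G gG; under eq_bigr => w _ do rewrite add_leafE mulrDr.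
  rewrite big_split /= !degree_edge_tail_succ natrD.
  by rewrite (edge_sum_tailC j) (edge_sum_tailC j.+1); ring.
Qed.

(** * Functions of the truncated degree as combinations of tail counts *)

Definition increment (y : nat -> R) i : R := y i - (if i is i'.+1 then y i' else 0).

(** Telescoping: the indicator keeps the increments of index at most [k.-1]. The shift by 1 appears
    because index [i] stands for degree [i.+1]. *)
Lemma sum_increment (y : nat -> R) K k : (0 < k)%N ->
  \sum_(i < K.+1) increment y i * (i < k)%N%:R = y (minn k.-1 K).
Proof.
move=> k0; elim: K => [|K IH].
  by rewrite big_ord_recl big_ord0 addr0 /= k0 mulr1 /increment subr0 minn0.
rewrite big_ord_recr /= IH /increment; case: k k0 {IH} => // k _; rewrite ltnS /=.
have [Kk|kK] := ltnP K k.
  by rewrite mulr1 (minn_idPr Kk) addrC subrK.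
by rewrite mulr0 addr0 (minn_idPl (leqW kK)).
Qed.

Lemma sum_increment2 (y : nat -> nat -> R) K k l : (0 < k)%N -> (0 < l)%N ->
  \sum_(i < K.+1) \sum_(j < K.+1)
    increment (fun a => increment (y a) j) i * edge_tail i j k l =
  y (minn k.-1 K) (minn l.-1 K).
Proof.
move=> k0 l0; rewrite exchange_big /= -[RHS](sum_increment _ _ l0).
apply: eq_bigr => j _; rewrite -(sum_increment (fun a => increment (y a) j) K k0).
rewrite mulr_suml; apply: eq_bigr => i _.
by rewrite /edge_tail -mulnb natrM mulrA.
Qed.

(** The energy bound for weights depending on the degree truncated at [K.+1], with [y] standing for
    an upper bound of the inverse [(x i + x j)^-1]. *)
Definition degree_bound (K : nat) (x : nat -> R) (y : nat -> nat -> R)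
    n (G : sgraph n) : R :=
  vert_sum (fun k => x (minn k.-1 K)) G +
  edge_sum (fun k l => y (minn k.-1 K) (minn l.-1 K)) G / 2.

Definition degree_bound_lim (K : nat) (x : nat -> R) (y : nat -> nat -> R) : R :=
  \sum_(i < K.+1) increment x i * (2 / (i.+1%:R * i.+2%:R)) +
  (\sum_(i < K.+1) \sum_(j < K.+1)
     increment (fun a => increment (y a) j) i * edge_lim i j) / 2.

(** Both sums are finite linear combinations of tail counts, with the increments of [x] and [y] as
    coefficients. *)
Lemma lln_degree_bound K x y :
  lln (degree_bound K x y) (degree_bound_lim K x y).
Proof.
pose c i j := increment (fun a => increment (y a) j) i.
(* The factors [1 *] in [he] below give its outer sum the shape required by [lln_sum]. *)
have hv := lln_sum (index_enum 'I_K.+1) (increment x \o val)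
  (fun i => lln_vert_tail (val i)).
have he : lln (fun n (G : sgraph n) => \sum_(i < K.+1) 1 * \sum_(j < K.+1)
     c i j * edge_sum (edge_tail i j) G)
   (\sum_(i < K.+1) 1 * \sum_(j < K.+1) c i j * edge_lim i j).
  apply: lln_sum => i.
  apply: (@lln_sum _ _ (fun j : 'I_K.+1 => @edge_sum R (edge_tail i j))).
  by move=> j; exact: lln_edge_tail.
have := lln_linear 2^-1 he hv; rewrite addrC mulrC.
under [in X in _ + X]eq_bigr do rewrite mul1r.
apply: eq_lln => n G gG; rewrite addrC mulrC; congr (_ + _ / 2).
  rewrite /vert_sum; under eq_bigr => i _ do rewrite mulr_sumr.
  rewrite exchange_big /=; apply: eq_bigr => v _.
  by rewrite -sum_increment // grown_degree_gt0.
transitivity (\sum_u \sum_(v | adj G u v) \sum_(i < K.+1) \sum_(j < K.+1)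
    c i j * edge_tail i j (degree G u) (degree G v)); last first.
  apply: eq_bigr => u _; apply: eq_bigr => v _.
  by rewrite sum_increment2 // grown_degree_gt0.
under [RHS]eq_bigr => u _ do rewrite exchange_big.
rewrite [RHS]exchange_big /=; apply: eq_bigr => i _; rewrite mul1r.
under [RHS]eq_bigr => u _ do rewrite exchange_big.
rewrite [RHS]exchange_big /=; apply: eq_bigr => j _.
rewrite mulr_sumr; apply: eq_bigr => u _.
by rewrite mulr_sumr.
Qed.

End Law.

(** * The numerical weights *)

(* Close to the optimal weights for a cut-off at degree 8; index i stands for
   degree i + 1. Leaves would optimally get weight 0: 1 / 1000 only keeps the
   weights positive. *)
Definition tenths (i : nat) : nat := nth 0%N [:: 0; 10; 13; 16; 18; 20; 22; 35]%N i.

Definition vert_weight (R : realType) (i : nat) : R :=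
  if i is 0 then 1 / 1000 else (tenths i)%:R / 10.

(* Two leaves are never adjacent for n > 2, so the value 500 at (0, 0) does not
   contribute to the limit. *)
Definition edge_weight (R : realType) (i j : nat) : R :=
  if (i + j)%N is 0 then 500 else 10 / (tenths i + tenths j)%:R.

Lemma degree_bound_lim_weight (R : realType) :
  degree_bound_lim 7 (vert_weight R) (edge_weight R) <= 96%:R / 100%:R.
Proof.
rewrite /degree_bound_lim.
(* Sums over ordinals become sums over ranges of naturals, which unfold to explicit rational
   constants. *)
pose p i := increment (vert_weight R) i * (2 / (i.+1%:R * i.+2%:R)).
pose q i j := increment (fun a => increment (edge_weight R a) j) i * edge_lim R i j.
rewrite -(big_mkord predT p) -(big_mkord predT (fun i => \sum_(j < 8) q i j)).
under [X in _ + X / _]eq_bigr => i _ do rewrite -(big_mkord predT (q i)).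
rewrite unlock /= /p /q /increment /edge_lim /edge_weight /vert_weight /=.
rewrite /tenths /addn /addn_rec /=.
lra.
Qed.

Lemma vert_weight_gt0 (R : realType) i : (i <= 7)%N -> 0 < vert_weight R i.
Proof.
by case: i => [|[|[|[|[|[|[|[|//]]]]]]]] _; rewrite divr_gt0 ?ltr0n.
Qed.

(** Equality holds unless exactly one index is 0; there, dropping [1 / 1000] from the denominator
    enlarges the value. *)
Lemma edge_weight_ge (R : realType) i j : (i <= 7)%N -> (j <= 7)%N ->
  (vert_weight R i + vert_weight R j)^-1 <= edge_weight R i j.
Proof.
have pos k : (k < 7)%N -> 0 < (tenths k.+1)%:R :> R.
  by case: k => [|[|[|[|[|[|[|//]]]]]]] _; rewrite ltr0n.
case: i j => [|i] [|j] i7 j7; rewrite /edge_weight ?addnS ?addSn /vert_weight.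
- by rewrite invf_ple ?posrE; lra.
- rewrite -[tenths 0]/(0%N) add0n; move: (pos j j7).
  by move: (tenths j.+1)%:R => t t0; rewrite -[leRHS]invf_div lef_pV2 ?posrE; lra.
- rewrite -[tenths 0]/(0%N) addn0; move: (pos i i7).
  by move: (tenths i.+1)%:R => t t0; rewrite -[leRHS]invf_div lef_pV2 ?posrE; lra.
- by rewrite natrD -[leRHS]invf_div mulrDl.
Qed.

(** This covers every graph, grown or not: [0.-1] is [0], so isolated vertices get the weight of
    leaves. *)
Lemma energy_le_degree_bound (R : realType) K (x : nat -> R) (y : nat -> nat -> R)
    n (G : sgraph n) :
  (forall i, (i <= K)%N -> 0 < x i) ->
  (forall i j, (i <= K)%N -> (j <= K)%N -> (x i + x j)^-1 <= y i j) ->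
  energy R G <= degree_bound K x y G.
Proof.
move=> x0 xy.
apply: le_trans (@energy_le _ _ G (fun v => x (minn (degree G v).-1 K)) _) _.
  by move=> v; apply: x0; exact: geq_minr.
rewrite lerD2l ler_pM2r ?invr_gt0 ?ltr0n //.
by apply: ler_sum => u _; apply: ler_sum => v _; apply: xy; exact: geq_minr.
Qed.

(** * Chebyshev's inequality and convergence in probability *)

Section Limit.
Variables (R : realType) (d : measure_display) (Omega : measurableType d).
Variables (P : probability Omega R) (T : forall n : nat, Omega -> sgraph n).
Hypothesis hT : barabasi_albert P T.

(** On the bad event [X] exceeds [c * (n - 1)] by at least [eps * n], because
    [c * (n - 1) <= b * n]. Dividing the second moment by [(eps * n) ^+ 2] leaves order [1 / n]. *)
Lemma lln_tail_prob (X Y : forall n, sgraph n -> R) c b eps :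
  lln P T X c -> c <= b -> 0 <= b -> 0 < eps ->
  (forall n (G : sgraph n), Y n G <= X n G) ->
  exists B, forall n, (1 < n)%N ->
    \sum_(G : sgraph n | ~~ (Y n G / n%:R <= b + eps)) law P T G <= B / n%:R.
Proof.
move=> [A hA] cb b0 eps0 YX; exists (`|A| / eps ^+ 2) => n n1.
have n0 : 0 < n%:R :> R by rewrite ltr0n ltnW.
have N0 : 0 <= n%:R - 1 :> R by rewrite subr_ge0 ler1n ltnW.
apply: (@le_trans _ _ (mean P T (fun G : sgraph n =>
    ((eps * n%:R) ^+ 2)^-1 * (X n G - c * (n%:R - 1)) ^+ 2))).
  rewrite big_mkcond; apply: ler_sum => G _; case: ifPn => [|_]; last first.
    by rewrite mulr_ge0 ?law_ge0 // mulr_ge0 ?invr_ge0 ?sqr_ge0.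
  rewrite -ltNge ltr_pdivlMr // => hY.
  rewrite -[leLHS]mulr1 ler_wpM2l ?law_ge0 //.
  rewrite ler_pdivlMl ?exprn_gt0 ?mulr_gt0 // mulr1.
  have dev : eps * n%:R <= X n G - c * (n%:R - 1).
    have : c * (n%:R - 1) <= b * n%:R.
      apply: le_trans (ler_wpM2r N0 cb) _.
      by rewrite ler_wpM2l // gerBl.
    have := YX n G; lra.
  have e0 : 0 <= eps * n%:R by rewrite mulr_ge0 // ltW.
  by rewrite ler_sqr ?nnegrE // (le_trans e0 dev).
rewrite meanZ exprMn invfM.
apply: (@le_trans _ _ ((eps ^- 2 * n%:R ^- 2) * (`|A| * n%:R))).
  rewrite ler_wpM2l ?mulr_ge0 ?invr_ge0 ?sqr_ge0 //.
  apply: le_trans (hA n n1) _; apply: (@le_trans _ _ (`|A| * (n%:R - 1))).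
    by rewrite ler_wpM2r // ler_norm.
  by rewrite ler_wpM2l // gerBl.
rewrite le_eqVlt; apply/orP; left; apply/eqP.
by field; rewrite !gt_eqF.
Qed.

Lemma prob_cvg1 (A : forall n, pred (sgraph n)) B :
  (forall n, (1 < n)%N -> \sum_(G : sgraph n | ~~ A n G) law P T G <= B / n%:R) ->
  P [set w | A n (T n w)] @[n --> \oo] --> 1%E.
Proof.
move=> hB.
rewrite (_ : (fun n => _) =
    (fun n => (1 - \sum_(G : sgraph n | ~~ A n G) law P T G)%:E)).
  apply: cvg_EFin; first by near=> n.
  rewrite -[X in _ --> X]subr0; apply: cvgB; first exact: cvg_cst.
  (* [harmonic n] is [1 / (n + 1)]; the factor 2 comes from [1 / n <= 2 / (n + 1)]. *)
  apply: (@squeeze_cvgr _ _ _ _ (fun=> 0) (fun n => `|B| * 2 * harmonic n)).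
  - near=> n; have n1 : (1 < n)%N by near: n; exists 2%N.
    rewrite sumr_ge0 => [/=|G _]; last exact: law_ge0.
    apply: le_trans (hB n n1) _.
    apply: (@le_trans _ _ (`|B| / n%:R)).
      by rewrite ler_wpM2r ?invr_ge0 ?ler0n // ler_norm.
    rewrite -mulrA ler_wpM2l // /harmonic ler_pdivlMr ?ltr0n //.
    rewrite mulrC ler_pdivrMr ?ltr0n 1?ltnW //.
    by rewrite -natrM ler_nat mul2n -addnn -addn1 leq_add2l ltnW.
  - exact: cvg_cst.
  - rewrite -[X in _ --> X](mulr0 (`|B| * 2)); apply: cvgM; first exact: cvg_cst.
    exact: cvg_harmonic.
apply/funext => n; rewrite (prob_pred hT (A n)); congr EFin.
by rewrite -(law_sum hT n) [in RHS](bigID (A n)) /= addrK.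
Unshelve. all: by end_near.
Qed.
End Limit.

Theorem theorem7 (R : realType) (d : measure_display)
    (Omega : measurableType d) (P : probability Omega R)
    (T : forall n : nat, Omega -> sgraph n) (hT : barabasi_albert P T)
    (eps : R) (heps : 0 < eps) :
  P [set w | energy R (T n w) / n%:R <= 96%:R / 100%:R + eps] @[n --> \oo]
    --> 1%E.
Proof.
have b0 : 0 <= 96%:R / 100%:R :> R by rewrite divr_ge0 ?ler0n.
(* The cut-off index 7 corresponds to degree 8, the last of the eight weights. *)
have [B hB] := lln_tail_prob (lln_degree_bound hT 7 (vert_weight R) (edge_weight R))
  (degree_bound_lim_weight R) b0 heps 
  (fun n G => energy_le_degree_bound G (@vert_weight_gt0 R) (@edge_weight_ge R)).
pose A n (G : sgraph n) := energy R G / n%:R <= 96%:R / 100%:R + eps.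
exact: (@prob_cvg1 _ _ _ _ _ hT A B hB).
Qed.
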